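(* Let $(N,+,* )$ be a finite a-near-ring. Then there is a prime number $p$ such that $(N,+)$ is a group of exponent $p$ and the additive order of the identity $1$ is $p$.
   Context: A near-ring $(N,+,* )$ is a (not necessarily abelian) group $(N,+)$ with identity element $0$ together with a semigroup $(N,* )$ satisfying the right distributive law $(a+b)*c=a*c+b*c$. It is zero symmetric if $0*n=n*0=0$ for all $n$. For a near-ring with multiplicative identity $1$, $U$ denotes the group of multiplicatively invertible elements (units). A near-field is a (zero symmetric) near-ring whose non-zero elements form a group under multiplication. An a-near-ring is a zero symmetric near-ring with identity such that $U\cup\{0\}$ forms a subnear-field with respect to the near-ring operations (equivalently $1\neq 0$ and $U\cup\{0\}$ is a subgroup of $(N,+)$). The exponent of a finite group is the least common multiple of the orders of its elements. *)

(* Defs.v *)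
From mathcomp Require Import all_boot all_fingroup all_solvable.

Set Implicit Arguments.
Unset Strict Implicit.
Unset Printing Implicit Defensive.

Local Open Scope group_scope.

(* The additive group (N, +), not assumed abelian, is a [finGroupType] [N].
   MathComp writes its operation multiplicatively: for [x y : N], [x * y] is
   the near-ring SUM, [1] is the near-ring ZERO, [#[x]] is the additive order.
   The near-ring product is a separate function [mul : N -> N -> N] and the
   multiplicative identity is [one : N]. *)

(* MathComp's [left_distributive mul add] says (a + b) c = a c + b c, which is
   the law called RIGHT distributive in the near-ring literature. *)
Record near_ring (N : finGroupType) (mul : N -> N -> N) : Prop := NearRing {
  near_ring_mulA : associative mul;
  near_ring_mulDl : left_distributive mul (fun x y : N => x * y) }.

Definition zero_symmetric (N : finGroupType) (mul : N -> N -> N) : Prop :=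
  left_zero (1 : N) mul /\ right_zero (1 : N) mul.

Definition nr_identity (N : finGroupType) (mul : N -> N -> N) (one : N) : Prop :=
  left_id one mul /\ right_id one mul.

Definition nr_units (N : finGroupType) (mul : N -> N -> N) (one : N) : {set N} :=
  [set x | [exists y, (mul x y == one) && (mul y x == one)]].

Record group_under (T : finType) (op : T -> T -> T) (S : {set T}) : Prop :=
  GroupUnder {
    group_under_closed : {in S &, forall x y, op x y \in S};
    group_under_assoc : {in S & &, forall x y z, op x (op y z) = op (op x y) z};
    group_under_id_inv : exists2 e, e \in S &
      {in S, forall x, [/\ op e x = x, op x e = x &
         exists2 y, y \in S & op x y = e /\ op y x = e]} }.

(* [S] is a subnear-field: a subgroup of (N, +) stable under the product, whose
   nonzero elements form a group under the product.  The remaining axioms of a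
   near-field (associativity, distributivity, zero symmetry) are universally
   quantified identities, so [S] inherits them from the zero symmetric
   near-ring N. *)
Record subnear_field (N : finGroupType) (mul : N -> N -> N) (S : {set N}) :
    Prop := SubnearField {
  subnear_field_add : group_set S;
  subnear_field_mul : {in S &, forall x y, mul x y \in S};
  subnear_field_nonzero : group_under mul (S :\ 1) }.

Record a_near_ring (N : finGroupType) (mul : N -> N -> N) (one : N) : Prop :=
  ANearRing {
    a_near_ring_near_ring : near_ring mul;
    a_near_ring_zero_symmetric : zero_symmetric mul;
    a_near_ring_identity : nr_identity mul one;
    a_near_ring_units : subnear_field mul (1 |: nr_units mul one) }.

(* Main.v *)
(* Right distributivity gives (k.1)x = k.x, so the additive order n of 1
   annihilates N. If n had a proper divisor d > 1, then d.1 would be a nonzero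
   element of U ∪ {0}, hence a unit, and (d.1)((n/d).1) = 0 would force
   (n/d).1 = 0, against the minimality of n. *)
Require Import Defs.
From mathcomp Require Import all_boot all_fingroup all_solvable.

Section NearRing.

Local Open Scope group_scope.

Variables (N : finGroupType) (mul : N -> N -> N) (one : N).

Lemma mul_one_expg : near_ring mul -> zero_symmetric mul ->
  nr_identity mul one -> forall k x, mul (one ^+ k) x = x ^+ k.
Proof.
move=> [_ mulDl] [mul0 _] [mul1 _] k x.
elim: k => [|k IHk]; first by rewrite !expg0 mul0.
by rewrite !expgS mulDl mul1 IHk.
Qed.

(** Multiply on the left by the inverse [v] of [u]; here v0 = 0 comes from zero symmetry, as right
    distributivity only yields 0v = 0. *)
Lemma unit_mul_eq0 : near_ring mul -> zero_symmetric mul ->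
  nr_identity mul one ->
  forall u x, u \in nr_units mul one -> mul u x = 1 -> x = 1.
Proof.
move=> [mulA _] [_ mulx0] [mul1 _] u x; rewrite inE.
case/existsP=> v /andP[_ /eqP vu1] ux0.
by rewrite -(mul1 x) -vu1 -mulA ux0 mulx0.
Qed.

(** The nonzero part of U ∪ {0}, being a group, has a neutral element [e]; if [one] were zero, then
    e = e one = 0. *)
Lemma a_near_ring_one_neq0 : a_near_ring mul one -> one != 1.
Proof.
case=> _ [_ mulx0] [_ mulx1] [_ _ [_ _ [e]]].
rewrite !inE => /andP[e_neq0 _] _; apply: contraNneq e_neq0 => one0.
by rewrite -(mulx1 e) one0 mulx0.
Qed.

(** U ∪ {0} is an additive subgroup containing [one], hence all its multiples. *)
Lemma expg_one_unit : a_near_ring mul one ->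
  forall k, one ^+ k != 1 -> one ^+ k \in nr_units mul one.
Proof.
case=> _ _ [mul1 _] [gS _ _] k k1_neq0.
have one_in : one \in group gS.
  by rewrite !inE; apply/orP; right; apply/existsP; exists one; rewrite mul1 eqxx.
by have := groupX k one_in; rewrite in_setU1 (negPf k1_neq0).
Qed.

Lemma prime_order_one : a_near_ring mul one -> prime #[one].
Proof.
move=> hN; have [nr zs id1 _] := hN.
apply/primeP; split=> [|d d_dvd].
  by rewrite order_gt1 a_near_ring_one_neq0.
have [d1_eq0 | d1_neq0] := eqVneq (one ^+ d) 1.
  by rewrite [d == #[one]]eqn_dvd d_dvd order_dvdn d1_eq0 eqxx orbT.
have cofactor0 : one ^+ (#[one] %/ d) = 1.
  apply: (unit_mul_eq0 nr zs id1 _ _ (expg_one_unit hN _ d1_neq0)).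
  by rewrite mul_one_expg // -expgM divnK // expg_order.
have d_gt0 : 0 < d by apply: dvdn_gt0 d_dvd.
have : #[one] %| #[one] %/ d by rewrite order_dvdn cofactor0.
(* With n = [#[one]], n dividing n/d means nd divides n, so d = 1. *)
rewrite dvdn_divRL // -{2}[#[one]]muln1 dvdn_pmul2l // dvdn1 => ->.
by [].
Qed.

End NearRing.

Theorem theorem5p2 (N : finGroupType) (mul : N -> N -> N) (one : N)
    (hN : a_near_ring mul one) :
  exists p : nat, [/\ prime p, exponent [set: N] = p & #[one]%g = p].
Proof.
have [nr zs id1 _] := hN.
exists #[one]%g; split=> //; first exact: (prime_order_one _ _ _ hN).
(* The order n of [one] divides the exponent; conversely n.x = (n.1)x = 0x = 0 for every x. *)
apply/eqP; rewrite eqn_dvd dvdn_exponent ?inE // andbT.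
apply/exponentP=> x _.
by rewrite -(mul_one_expg _ _ _ nr zs id1) expg_order; have [-> _] := zs.
Qed.
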